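(* Let $\mathcal{X}\subseteq\mathbb{R}^d$ and let $D$ be any distribution over $\mathcal{X}\times\{\pm1\}$ whose class-probability function satisfies $\eta\in\mathrm{SIM}(L,W)$, say $\eta(x)=u(\langle w^*,x\rangle)$ with $u\colon\mathbb{R}\to[0,1]$ non-decreasing and $L$-Lipschitz and $\|w^*\|\le W$. Suppose $\bar D=\mathrm{SIN}(D,f_{-1},f_1)$, where $(f_{-1},f_1,s^*,\eta)$ are $\mathrm{BCN}^+$-admissible for $s^*(x)=\langle w^*,x\rangle$, and $f_{-1},f_1$ are $L_{-1}$-Lipschitz and $L_1$-Lipschitz respectively. Then the class-probability function $\bar\eta$ of $\bar D$ satisfies $\bar\eta\in\mathrm{SIM}(L+L_{-1}+L_1,W)$. In particular, $\bar\eta(x)=\bar u(\langle w^*,x\rangle)$, where $$\bar u(z)=(1-f_1(z))\cdot u(z)+f_{-1}(z)\cdot(1-u(z)).$$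
   Context: A distribution $D$ over $\mathcal{X}\times\{\pm1\}$ of a pair $(X,Y)$ is determined by its marginal $M=\mathbb{P}(X)$ and class-probability function $\eta(x)=\mathbb{P}(Y=1\mid X=x)$; $\pi=\mathbb{P}(Y=1)\in(0,1)$. For $u\colon\mathbb{R}\to[0,1]$ and $w^*\in\mathbb{R}^d$, $\mathrm{GLM}(u,w^* )$ is the function $x\mapsto u(\langle w^*,x\rangle)$. For $L,W\in\mathbb{R}_+$, $\mathrm{SIM}(L,W)$ is the set of $\mathrm{GLM}(u,w^* )$ with $u\colon\mathbb{R}\to[0,1]$ non-decreasing and $L$-Lipschitz and $\|w^*\|\le W$. Instance- and label-dependent noise: for $\rho_1,\rho_{-1}\colon\mathcal{X}\to[0,1]$, $\mathrm{ILN}(D,\rho_{-1},\rho_1)$ is the distribution of $(X,\bar Y)$ obtained by drawing $(X,Y)\sim D$ and flipping the label with probability $\rho_Y(X)$; $\bar\eta(x)=\mathbb{P}(\bar Y=1\mid X=x)$. Standing assumption (bounded total noise): $\rho_1(x)+\rho_{-1}(x)<1$ for all $x\in\mathcal{X}$. $\mathrm{BCN}^+$ model: given $f_{\pm1}\colon\mathbb{R}\to[0,1]$ and $s\colon\mathcal{X}\to\mathbb{R}$, $\mathrm{BCN}^+(D,f_{-1},f_1,s)=\mathrm{ILN}(D,\rho_{-1},\rho_1)$ with $\rho_y=f_y\circ s$. The tuple $(f_{-1},f_1,s,\eta)$ is $\mathrm{BCN}^+$-admissible if: (a) for all $x,x'\in\mathcal{X}$, $\eta(x)<\eta(x')\implies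 s(x)<s(x')$; (b) $f_{\pm1}$ are non-decreasing where $\eta\le\frac12$ and non-increasing where $\eta\ge\frac12$, i.e. for $y\in\{\pm1\}$ and all $x,x'$ with $s(x)\le s(x')$: if $\eta(x),\eta(x')\le\frac12$ then $f_y(s(x))\le f_y(s(x'))$, and if $\eta(x),\eta(x')\ge\frac12$ then $f_y(s(x))\ge f_y(s(x'))$; (c) $\Delta(z)=f_1(z)-f_{-1}(z)$ is non-increasing in $z$. Single index noise: for $D$ with $\eta=\mathrm{GLM}(u,w^* )$, $\mathrm{SIN}(D,f_{-1},f_1)=\mathrm{BCN}^+(D,f_{-1},f_1,s^* )$ with $s^*(x)=\langle w^*,x\rangle$. *)

(* Defs.v *)
From HB Require Import structures.
From mathcomp Require Import all_boot all_order all_algebra.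
From mathcomp Require Import all_classical all_reals all_analysis.

Set Implicit Arguments.
Unset Strict Implicit.
Unset Printing Implicit Defensive.

Import Order.TTheory GRing.Theory Num.Theory.
Import numFieldNormedType.Exports.

Local Open Scope classical_set_scope.
Local Open Scope ring_scope.

Definition inner (R : realType) (d : nat) (v x : 'rV[R]_d) : R :=
  \sum_(i < d) v 0 i * x 0 i.

(* The canonical norm of 'rV[R]_d is the sup norm, hence this definition. *)
Definition enorm (R : realType) (d : nat) (v : 'rV[R]_d) : R :=
  Num.sqrt (inner v v).

Definition borel (R : realType) (d : nat) :=
  g_sigma_algebraType (@open 'rV[R]_d).

(* The subset X of R^d as a measurable space, with the trace of the Borel
   sigma-algebra; X itself need not be Borel.  The nonemptiness proof only
   provides the default point required of a measurableType; it is no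
   restriction, since the empty set carries no probability. *)
Definition domain (R : realType) (d : nat) (X : set 'rV[R]_d)
  (X0 : X !=set0) : Type := set_type X.

Section domain_structure.
Context (R : realType) (d : nat) (X : set 'rV[R]_d) (X0 : X !=set0).

HB.instance Definition _ := Choice.on (domain X0).
HB.instance Definition _ := isPointed.Build (domain X0)
  (SigSub (mem_set (projT2 (cid X0))) : set_type X).

Definition domain_val (x : domain X0) : borel R d := \val (x : set_type X).

HB.instance Definition _ :=
  Measurable.copy (domain X0) (g_sigma_algebra_preimageType domain_val).

End domain_structure.

Section distributions.
Context (disp : measure_display) (T : measurableType disp) (R : realType).

HB.instance Definition _ :=
  isMeasurableFun.Build _ _ _ _ (@fst T bool) measurable_fst.

(* The label set {+1, -1} is bool: true is +1 and false is -1. *)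
Implicit Types (D Dbar : probability (T * bool)%type R).

Definition marginal D : set T -> \bar R :=
  distribution D (@fst T bool).
HB.instance Definition _ D := Probability.on (marginal D).

(* eta is a version of x |-> P(Y = 1 | X = x). *)
Definition class_probability D (eta : T -> R) : Prop :=
  [/\ measurable_fun [set: T] eta,
      (forall x, 0 <= eta x <= 1) &
      forall A : set T, measurable A ->
        D (A `*` [set true]) = (\int[marginal D]_(x in A) (eta x)%:E)%E].

(* Dbar is the law of (X, Ybar), where (X, Y) ~ D and, given (X, Y),
   Ybar = -Y with probability rho_Y(X) and Ybar = Y otherwise. *)
Definition ILN D (rhom1 rho1 : T -> R) Dbar : Prop :=
  let rho (p : T * bool) := if p.2 then rho1 p.1 else rhom1 p.1 in
  forall B : set (T * bool), measurable B ->
    Dbar B = (\int[D]_p ((1 - rho p)%:E * \d_p B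
                         + (rho p)%:E * \d_(p.1, ~~ p.2) B))%E.

Definition bounded_total_noise (rhom1 rho1 : T -> R) : Prop :=
  forall x, rho1 x + rhom1 x < 1.

Definition BCNp D (fm1 f1 : R -> R) (s : T -> R) Dbar : Prop :=
  ILN D (fm1 \o s) (f1 \o s) Dbar.

Definition boundary_monotone (f : R -> R) (s eta : T -> R) : Prop :=
  forall x x', s x <= s x' ->
    (eta x <= 2^-1 -> eta x' <= 2^-1 -> f (s x) <= f (s x')) /\
    (2^-1 <= eta x -> 2^-1 <= eta x' -> f (s x') <= f (s x)).

Definition BCNp_admissible (fm1 f1 : R -> R) (s eta : T -> R) : Prop :=
  [/\ (forall x x', eta x < eta x' -> s x < s x'),
      boundary_monotone fm1 s eta /\ boundary_monotone f1 s eta &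
      {homo (fun z => f1 z - fm1 z) : z z' /~ z <= z'}].

End distributions.

Definition unit_valued (R : realType) (f : R -> R) : Prop :=
  forall z, 0 <= f z <= 1.

Section single_index.
Context (R : realType) (d : nat) (X : set 'rV[R]_d) (X0 : X !=set0).

Definition score (w : 'rV[R]_d) (x : domain X0) : R :=
  inner w (domain_val x).

Definition GLM (u : R -> R) (w : 'rV[R]_d) : domain X0 -> R :=
  fun x => u (score w x).

Definition SIM_parameters (L W : R) (u : R -> R) (w : 'rV[R]_d) : Prop :=
  [/\ unit_valued u, {homo u : z z' / z <= z'}, L.-lipschitz u & enorm w <= W].

Definition SIM (L W : R) : set (domain X0 -> R) :=
  [set h | exists u w, SIM_parameters L W u w /\ h = GLM u w].

Definition SIN (D : probability (domain X0 * bool)%type R)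
    (w : 'rV[R]_d) (fm1 f1 : R -> R)
    (Dbar : probability (domain X0 * bool)%type R) : Prop :=
  BCNp D fm1 f1 (score w) Dbar.

End single_index.
Arguments score {R d X} X0.
Arguments GLM {R d X} X0.
Arguments SIM {R d X} X0.

(* Main.v *)
Require Import Defs.
From mathcomp Require Import all_boot all_order all_algebra.
From mathcomp Require Import all_classical all_reals all_analysis.
From mathcomp Require Import measurable_realfun lra ring.

Set Implicit Arguments.
Unset Strict Implicit.
Unset Printing Implicit Defensive.

Import Order.TTheory GRing.Theory Num.Theory.
Import numFieldNormedType.Exports.

Local Open Scope classical_set_scope.
Local Open Scope ring_scope.

(* The flip acts on the posterior affinely: conditioning (X, Ybar) on X gives
   (1 - rho_1) eta + rho_-1 (1 - eta), i.e. ubar composed with the score.  The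
   increment of ubar is
     (1 - f1 - fm1)(z) du - u(z') df1 + (1 - u(z')) dfm1,
   whose three coefficients have absolute value at most 1; this yields the
   Lipschitz constant, and, with admissibility, monotonicity.  Admissibility
   constrains f1 and fm1 only at scores of points of X, so ubar is monotone on
   the range of the score but possibly not on R; membership in SIM is therefore
   witnessed by a monotone Lipschitz extension of ubar from that range. *)

(** * Lipschitz functions on the line and their monotone extension *)

Lemma lipschitz_dist (R : realType) (k : R) (f : R -> R) :
  k.-lipschitz f <-> forall z z', `|f z - f z'| <= k * `|z - z'|.
Proof.
split=> [fk z z'|fk [z z'] _ /=]; last exact: fk.
by have /= := fk (z, z'); apply; split.
Qed.

Lemma lipschitz_ge0 (R : realType) (k : R) (f : R -> R) :
  k.-lipschitz f -> 0 <= k.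
Proof.
move=> /lipschitz_dist/(_ 1 0); rewrite subr0 normr1 mulr1.
exact: le_trans.
Qed.

Lemma lipschitz_measurable (R : realType) (k : R) (f : R -> R) :
  k.-lipschitz f -> measurable_fun [set: R] f.
Proof.
move=> fk; have k0 := lipschitz_ge0 fk; move/lipschitz_dist in fk.
apply: continuous_measurable_fun => x; apply/cvgrPdist_lt => e e0.
(* The radius is [e / (k + 1)] rather than [e / k] because [k] may be 0. *)
have k1 : 0 < k + 1 by rewrite ltr_wpDl.
near=> y; rewrite (le_lt_trans (fk _ _))//.
have : `|x - y| < e / (k + 1).
  near: y; have /cvgrPdist_lt := @cvg_id _ (nbhs x); apply.
  by rewrite divr_gt0.
rewrite ltr_pdivlMr// mulrC; apply: le_lt_trans.
by rewrite ler_wpM2r// lerDl.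
Unshelve. all: by end_near. Qed.

(* McShane's extension z |-> inf_(s in S) f s + k max(0, z - s), capped at 1. *)
Lemma monotone_lipschitz_extension (R : realType) (S : set R) (k : R)
    (f : R -> R) :
  S !=set0 -> {in S, forall z, 0 <= f z <= 1} ->
  {in S &, {homo f : z z' / z <= z'}} -> k.-lipschitz f ->
  exists g : R -> R, [/\ unit_valued g, {homo g : z z' / z <= z'},
    k.-lipschitz g & {in S, g =1 f}].
Proof.
move=> [s0 Ss0] f01 f_homo fk; have k0 := lipschitz_ge0 fk.
move/lipschitz_dist in fk.
pose E z := [set f s + k * Num.max 0 (z - s) | s in S].
have E0 z : E z !=set0 by eexists; exists s0.
have max0 (t : R) : 0 <= Num.max 0 t by rewrite le_max lexx.
have lbE z : lbound (E z) 0.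
  move=> _ [s Ss <-]; have /andP[f0 _] := f01 _ (mem_set Ss).
  by rewrite addr_ge0 ?mulr_ge0.
have infE z s : S s -> inf (E z) <= f s + k * Num.max 0 (z - s).
  by move=> Ss; apply: ge_inf; [exists 0; exact: lbE|exists s].
(* Subadditivity of the positive part, applied to [z' - s = (z' - z) + (z - s)]. This one-sided
   bound gives both monotonicity ([z' <= z]) and the Lipschitz constant. *)
have inf_shift z z' : inf (E z') <= inf (E z) + k * Num.max 0 (z' - z).
  rewrite -lerBlDr; apply: lb_le_inf => // _ [s Ss <-].
  rewrite lerBlDr (le_trans (infE z' s Ss))// -addrA lerD2l -mulrDr.
  rewrite ler_wpM2l// ge_max addr_ge0//=.
  by rewrite -(subrKA z) addrC lerD// le_max lexx orbT.
have inf_homo z z' : z <= z' -> inf (E z) <= inf (E z').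
  move=> zz'; rewrite (le_trans (inf_shift z' z))//.
  by rewrite max_l ?subr_le0// mulr0 addr0.
have infS z : S z -> inf (E z) = f z.
  move=> Sz; apply/le_anti/andP; split.
    by rewrite (le_trans (infE z z Sz))// subrr maxxx mulr0 addr0.
  (* Points [s >= z] are handled by monotonicity of [f] on [S], points [s < z] by its Lipschitz
     bound. *)
  apply: lb_le_inf => // _ [s Ss <-]; have [zs|sz] := leP z s.
    by rewrite max_l ?subr_le0// mulr0 addr0 f_homo ?inE.
  rewrite max_r ?subr_ge0 ?(ltW sz)//.
  rewrite -lerBlDl.
  by rewrite -[X in k * X]gtr0_norm ?subr_gt0// (le_trans (ler_norm _)).
exists (fun z => Num.min 1 (inf (E z))); split.
- by move=> z; rewrite le_min ler01/= lb_le_inf//= ge_min lexx.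
- by move=> z z' zz'; rewrite le_min !ge_min lexx inf_homo// orbT.
- apply/lipschitz_dist.
  have min_shift z z' : z <= z' ->
      `|Num.min 1 (inf (E z)) - Num.min 1 (inf (E z'))| <= k * `|z - z'|.
    move=> zz'; have h := inf_homo _ _ zz'; have := inf_shift z z'.
    rewrite max_r ?subr_ge0// => h'.
    rewrite !(distrC z) !(distrC (Num.min 1 (inf (E z)))).
    rewrite !ger0_norm ?subr_ge0//; last first.
      by rewrite le_min !ge_min lexx h orbT.
    have kz : 0 <= k * (z' - z) by rewrite mulr_ge0// subr_ge0.
    by rewrite /Num.min; case: ifPn; case: ifPn; rewrite -?leNgt; lra.
  move=> z z'; have [/min_shift//|/ltW/min_shift] := leP z z'.
  by rewrite distrC (distrC z').
- move=> z /set_mem Sz; rewrite infS// min_r//.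
  by have /andP[] := f01 _ (mem_set Sz).
Qed.

(** * Measurability of the score *)

Lemma measurable_score (R : realType) (d : nat) (X : set 'rV[R]_d)
    (X0 : X !=set0) (w : 'rV[R]_d) :
  measurable_fun [set: domain X0] (score X0 w).
Proof.
have inner_cont : continuous (@inner R d w).
  move=> x.
  apply: (@cvg_big R _ _ _ xpredT add_continuous _ (nbhs x)) => i _.
  by apply: cvgM; [exact: cvg_cst|exact: coord_continuous].
(* It suffices to treat open rays: their preimages under the continuous [inner w] are open, and
   their traces on [X] are measurable in [domain X0]. *)
apply: (measurability _ (RGenOInfty.measurableE R)) => //.
move=> _ [_ [r ->] <-]; rewrite setTI.
exists (@inner R d w @^-1` `]r, +oo[); last by rewrite setTI.
apply: sub_sigma_algebra; apply: open_comp => [x _|]; first exact: inner_cont.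
exact: rray_open.
Qed.

(** * Integration against a measure whose image has a density *)

Section density.
Context d d' (T : measurableType d) (T' : measurableType d') (R : realType).
Variables (m : {measure set T -> \bar R}) (m' : {measure set T' -> \bar R}).
Variables (phi : T -> T') (mphi : measurable_fun [set: T] phi).
Variables (S : set T) (mS : measurable S).
Variables (g : T' -> R) (mg : measurable_fun [set: T'] g).
Hypothesis g_ge0 : forall y, 0 <= g y.
(** That is, [g] is the density with respect to [m'] of the image under [phi] of [m] restricted to
    [S]. *)
Hypothesis m_phi : forall A, measurable A ->
  (m (S `&` phi @^-1` A) = \int[m']_(y in A) (g y)%:E)%E.

Local Open Scope ereal_scope.
Import HBNNSimple.

(** By linearity over the values of [h], this reduces to indicators of level sets, where it is
    [m_phi]. *)
Let density_nnsfun (h : {nnsfun T' >-> R}) :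
  \int[m]_(x in S) (h (phi x))%:E = \int[m']_y ((h y)%:E * (g y)%:E).
Proof.
have mpre r : measurable (phi @^-1` (h @^-1` [set r])).
  by rewrite -[X in measurable X]setTI; exact: mphi.
transitivity (\sum_(r \in range h)
    \int[m]_(x in S) (r * \1_(phi @^-1` (h @^-1` [set r])) x)%:E).
  rewrite -ge0_integral_fsum//.
  - by apply: eq_integral => x _; rewrite fsumEFin// -fimfunE.
  - by move=> r; exact/measurable_EFinP/measurable_funTS/measurable_funM.
  - by move=> r x _; exact: (nnfun_muleindic_ge0 h r (phi x)).
transitivity (\sum_(r \in range h)
    \int[m']_y (r%:E * ((\1_(h @^-1` [set r]) y)%:E * (g y)%:E))); last first.
  rewrite -ge0_integral_fsum//.
  - apply: eq_integral => y _; rewrite fimfunE -fsumEFin// ge0_mule_fsuml//.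
      by apply: eq_fsbigr => r _; rewrite EFinM muleA.
    by move=> r; exact: nnfun_muleindic_ge0.
  - move=> r; apply: emeasurable_funM => //; apply: emeasurable_funM.
      exact/measurable_EFinP.
    exact/measurable_EFinP.
  - move=> r y _; rewrite muleA mule_ge0 ?lee_fin//.
    exact: (nnfun_muleindic_ge0 h r y).
apply: eq_fsbigr => r rh; have r0 : (0 <= r)%R.
  by move: rh => /set_mem[y _ <-].
rewrite (integralZl_indic _ (fun=> phi @^-1` (h @^-1` [set r])))//; last first.
  by rewrite ltNge r0.
rewrite ge0_integralZl ?lee_fin//; last 2 first.
  - by apply: emeasurable_funM; exact/measurable_EFinP.
  - by move=> y _; rewrite mule_ge0 ?lee_fin.
congr (_ * _); rewrite integral_indic// setIC m_phi//.
rewrite integral_mkcond; apply: eq_integral => y _.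
by rewrite patchE indicE; case: ifPn => _; rewrite ?mul1e ?mul0e.
Qed.

(** Monotone convergence on both sides along simple functions increasing to [f]; multiplying by
    [g >= 0] keeps the sequence increasing. *)
Lemma ge0_integral_density (f : T' -> \bar R) :
    measurable_fun [set: T'] f -> (forall y, 0 <= f y) ->
  \int[m]_(x in S) f (phi x) = \int[m']_y (f y * (g y)%:E).
Proof.
move=> mf f0; pose f_ := nnsfun_approx measurableT mf.
transitivity (limn (fun n => \int[m]_(x in S) (f_ n (phi x))%:E)).
  rewrite -monotone_convergence//.
  - apply: eq_integral => x _; apply/esym/cvg_lim => //.
    by apply: cvg_nnsfun_approx => // *; exact: f0.
  - move=> n; apply: measurable_funTS; apply/measurable_EFinP.
    exact: measurableT_comp.
  - by move=> n x _; rewrite lee_fin.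
  - by move=> x _ n p np; rewrite lee_fin; exact/lefP/nd_nnsfun_approx.
transitivity (limn (fun n => \int[m']_y ((f_ n y)%:E * (g y)%:E))).
  by congr (limn _); apply/funext => n; exact: density_nnsfun.
rewrite -monotone_convergence//.
- apply: eq_integral => y _; apply/cvg_lim => //.
  apply: cvgeMr => //.
  by apply: cvg_nnsfun_approx => // *; exact: f0.
- by move=> n; apply: emeasurable_funM; exact/measurable_EFinP.
- by move=> n y _; rewrite mule_ge0 ?lee_fin.
- move=> y _ n p np; rewrite lee_wpmul2r ?lee_fin//.
  exact/lefP/nd_nnsfun_approx.
Qed.

End density.

(** * The noisy link: range, Lipschitz constant, monotonicity *)

Section noisy_link.
Context (R : realType) (u fm1 f1 : R -> R).

Definition noisy_link (z : R) : R :=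
  (1 - f1 z) * u z + fm1 z * (1 - u z).

Lemma noisy_link01 :
  unit_valued u -> unit_valued fm1 -> unit_valued f1 ->
  unit_valued noisy_link.
Proof.
move=> u01 fm101 f101 z; rewrite /noisy_link.
have /andP[? ?] := u01 z; have /andP[? ?] := fm101 z.
have /andP[? ?] := f101 z; apply/andP; split; nra.
Qed.

Lemma noisy_linkB z z' :
  noisy_link z - noisy_link z' =
  (1 - f1 z - fm1 z) * (u z - u z') - u z' * (f1 z - f1 z')
  + (1 - u z') * (fm1 z - fm1 z').
Proof. by rewrite /noisy_link; ring. Qed.

Lemma noisy_link_lipschitz (L Lm1 L1 : R) :
  unit_valued u -> unit_valued fm1 -> unit_valued f1 ->
  L.-lipschitz u -> Lm1.-lipschitz fm1 -> L1.-lipschitz f1 ->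
  (L + Lm1 + L1).-lipschitz noisy_link.
Proof.
move=> u01 fm101 f101 /lipschitz_dist uL /lipschitz_dist fm1L.
move=> /lipschitz_dist f1L.
apply/lipschitz_dist => z z'; rewrite noisy_linkB.
have /andP[u0 u1] := u01 z'; have /andP[? ?] := fm101 z.
have /andP[? ?] := f101 z.
have contract (a b : R) : `|a| <= 1 -> `|a * b| <= `|b|.
  by move=> a1; rewrite normrM ler_piMl.
(* The bound is reordered as [L], [L1], [Lm1] to match the three terms of [noisy_linkB]. *)
rewrite (mulrDl (L + Lm1)) (mulrDl L) [leRHS]addrAC.
rewrite (le_trans (ler_normD _ _))// lerD//.
  rewrite (le_trans (ler_normB _ _))// lerD//.
    by apply: le_trans (contract _ _ _) (uL _ _);
      rewrite ler_norml; apply/andP; split; lra.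
  by apply: le_trans (contract _ _ _) (f1L _ _);
    rewrite ler_norml; apply/andP; split; lra.
by apply: le_trans (contract _ _ _) (fm1L _ _);
  rewrite ler_norml; apply/andP; split; lra.
Qed.

(* When u (s x) <= 1/2 <= u (s y), compare the two values with 1/2, since
   noisy_link - 1/2 = (u - 1/2) (1 - f1 - fm1) - (f1 - fm1) / 2. *)
Lemma noisy_link_homo (disp : measure_display) (T : measurableType disp)
    (s : T -> R) :
    unit_valued u -> {homo u : z z' / z <= z'} ->
    bounded_total_noise (fm1 \o s) (f1 \o s) ->
    BCNp_admissible fm1 f1 s (u \o s) ->
  {in range s &, {homo noisy_link : z z' / z <= z'}}.
Proof.
move=> u01 u_homo noise [_ [fm1_bd f1_bd] D_homo]
  _ _ /set_mem[x _ <-] /set_mem[y _ <-] sxy.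
have /andP[ux0 ux1] := u01 (s x); have /andP[uy0 uy1] := u01 (s y).
have uxy := u_homo _ _ sxy; have /= D_le := D_homo _ _ sxy.
have /= nx := noise x; have /= ny := noise y.
have /= [fm1_le fm1_ge] := fm1_bd _ _ sxy.
have /= [f1_le f1_ge] := f1_bd _ _ sxy.
rewrite -subr_ge0 noisy_linkB.
have [uy|uy] := leP (u (s y)) 2^-1.
  have ux := le_trans uxy uy.
  (* With [a = u (s x) <= 1/2], [(1 - a) dfm1 - a df1 = (1 - 2 a) dfm1 + a (dfm1 - df1)], where
     [dfm1 >= 0] and [dfm1 >= df1]. *)
  have := fm1_le ux uy; have := f1_le ux uy; nra.
have [ux|ux] := leP 2^-1 (u (s x)).
  (* Now [a >= 1/2], and the same quantity equals [(1 - 2 a) df1 + (1 - a) (dfm1 - df1)] with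
     [df1 <= 0]. *)
  have := fm1_ge ux (ltW uy); have := f1_ge ux (ltW uy); nra.
nra.
Qed.

End noisy_link.

(** * Class probabilities and their transformation under label noise *)

Section class_probability_theory.
Context (disp : measure_display) (T : measurableType disp) (R : realType).
Implicit Type D : probability (T * bool)%type R.
Local Open Scope ereal_scope.

Lemma marginalE D (A : set T) : marginal D A = D (A `*` setT).
Proof. by rewrite setXT. Qed.

Lemma class_probability_integrable D (eta : T -> R) :
  class_probability D eta -> (marginal D).-integrable [set: T] (EFin \o eta).
Proof.
move=> [meta eta01 _].
apply: (@le_integrable _ _ _ _ _ measurableT _ (cst 1)).
- exact/measurable_EFinP.
- move=> x _ /=; have /andP[? ?] := eta01 x.
  by rewrite normr1 lee_fin ger0_norm.
- exact: finite_measure_integrable_cst.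
Qed.

(** Both functions have the same integral over every measurable set. This carries the formula from
    one version of the noisy class probability to all versions. *)
Lemma class_probability_ae_unique D (eta eta' : T -> R) :
  class_probability D eta -> class_probability D eta' ->
  {ae marginal D, forall x, eta x = eta' x}.
Proof.
move=> Deta [meta' eta'01 D_eta'].
have : ae_eq (marginal D) [set: T] (EFin \o eta) (EFin \o eta').
  apply: integral_ae_eq => //; first exact: class_probability_integrable.
    exact/measurable_EFinP.
  move=> A _ mA; have [_ _ D_eta] := Deta.
  by rewrite -D_eta// -D_eta'.
by apply: filterS => x /(_ I)[].
Qed.

Lemma class_probability_false D (eta : T -> R) (A : set T) :
  class_probability D eta -> measurable A ->
  D (A `*` [set false]) = \int[marginal D]_(x in A) (1 - eta x)%:E.
Proof.
move=> Deta mA; have [meta eta01 D_eta] := Deta.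
have itf : (marginal D).-integrable A (EFin \o eta).
  exact: integrableS (class_probability_integrable Deta).
under eq_integral do rewrite EFinB.
rewrite integralB//; last exact: finite_measure_integrable_cst.
rewrite integral_cst// mul1e -D_eta// [X in _ = X - _]marginalE.
have -> : A `*` setT = A `*` [set true] `|` A `*` [set false].
  by apply/seteqP; split=> [[x []] [] //=|[x b] [] []//]; [left|right].
rewrite measureU//; [|exact: measurableX..|]; last first.
  by apply/seteqP; split=> [[x b] [[_ /= ->] [_]]|].
by rewrite addeAC subee ?add0e// fin_num_measure//; exact: measurableX.
Qed.

(** On the slice of label [b], the first projection has density [eta] or [1 - eta] with respect to
    the marginal. *)
Lemma integral_class_probability D (eta : T -> R) (b : bool) (f : T -> \bar R) :
    class_probability D eta ->
    measurable_fun [set: T] f -> (forall x, 0 <= f x) ->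
  \int[D]_(p in setT `*` [set b]) f p.1 =
  \int[marginal D]_x (f x * (if b then eta x else 1 - eta x)%:E).
Proof.
move=> Deta; have [meta eta01 D_eta] := Deta.
apply: (ge0_integral_density (phi := fst)) => //.
- exact: measurableX.
- case: b => //; exact: measurable_funB.
- by move=> x; have /andP[? ?] := eta01 x; case: b; rewrite ?subr_ge0.
move=> A mA.
have -> : setT `*` [set b] `&` fst @^-1` A = A `*` [set b].
  by apply/seteqP; split=> [[x c] [[_ /=]]|[x c] []].
by case: b; [exact: D_eta|exact: class_probability_false].
Qed.

Lemma integral_class_probabilityE D (eta : T -> R) (f : bool -> T -> \bar R) :
    class_probability D eta ->
    (forall b, measurable_fun [set: T] (f b)) -> (forall b x, 0 <= f b x) ->
  \int[D]_p f p.2 p.1 =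
  \int[marginal D]_x (f true x * (eta x)%:E + f false x * (1 - eta x)%:E).
Proof.
move=> Deta mf f0; have [meta eta01 _] := Deta.
rewrite ge0_integralD//; last 4 first.
- by move=> x _; rewrite mule_ge0// lee_fin; have /andP[] := eta01 x.
- by apply: emeasurable_funM => //; exact/measurable_EFinP.
- move=> x _; rewrite mule_ge0// lee_fin subr_ge0.
  by have /andP[] := eta01 x.
- apply: emeasurable_funM => //; apply/measurable_EFinP.
  exact: measurable_funB.
rewrite -(integral_class_probability true Deta)//.
rewrite -(integral_class_probability false Deta)//.
have -> : [set: T * bool] = setT `*` [set true] `|` setT `*` [set false].
  by apply/seteqP; split=> [[x []]|//] _; [left|right].
rewrite ge0_integral_setU//.
- by congr (_ + _); apply: eq_integral => -[x b] /set_mem[_ /= ->].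
- exact: measurableX.
- exact: measurableX.
- apply: measurable_funTS.
  (* Written as a conditional on the label, the integrand is measurable branch by branch. *)
  rewrite (_ : (fun _ => _) =
      fun p => if p.2 then f true p.1 else f false p.1); last first.
    by apply/funext => -[x []].
  apply: measurable_fun_ifT; [exact: measurable_snd|..];
    exact: measurableT_comp.
- by apply/disj_setPS => -[x b] [[_ /= ->] [_]].
Qed.

Variables (rhom1 rho1 : T -> R).
Hypotheses (mrhom1 : measurable_fun [set: T] rhom1)
  (mrho1 : measurable_fun [set: T] rho1).
Hypotheses (rhom1_01 : forall x, (0 <= rhom1 x <= 1)%R)
  (rho1_01 : forall x, (0 <= rho1 x <= 1)%R).

(** The flip changes only the label, so both Dirac masses take the same value on [A * setT], and
    their weights add up to 1. *)
Lemma ILN_marginal D Dbar (A : set T) :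
  ILN D rhom1 rho1 Dbar -> measurable A -> marginal Dbar A = marginal D A.
Proof.
move=> DDbar mA.
have mAT : measurable (A `*` [set: bool]) by exact: measurableX.
rewrite !marginalE DDbar// -[in RHS](setIT (A `*` _)) -integral_indic//.
apply: eq_integral => -[x b] _ /=; rewrite !diracE indicE.
rewrite !(in_setX, in_setT) !andbT/=.
by rewrite -ge0_muleDl -?EFinD ?subrK ?mul1e//= lee_fin; case: b => /=;
  have /andP[? ?] := rhom1_01 x; have /andP[? ?] := rho1_01 x; lra.
Qed.

Lemma ILN_class_probability D Dbar (eta : T -> R) :
  class_probability D eta -> ILN D rhom1 rho1 Dbar ->
  class_probability Dbar
    (fun x => (1 - rho1 x) * eta x + rhom1 x * (1 - eta x))%R.
Proof.
move=> Deta DDbar; have [meta eta01 _] := Deta; split.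
- apply: measurable_funD; apply: measurable_funM => //; exact: measurable_funB.
- move=> x; have /andP[? ?] := eta01 x; have /andP[? ?] := rhom1_01 x.
  by have /andP[? ?] := rho1_01 x; apply/andP; split; nra.
move=> A mA; have mAt : measurable (A `*` [set true]) by exact: measurableX.
rewrite DDbar//.
(* A noisy positive is a positive that was kept or a negative that was flipped; [f b] is its
   conditional probability given the clean label [b], cut off to [A]. *)
pose f b x := ((if b then 1 - rho1 x else rhom1 x) * \1_A x)%:E.
transitivity (\int[D]_p f p.2 p.1).
  apply: eq_integral => -[x b] _ /=; rewrite !diracE /f indicE !in_setX/=.
  by case: b; rewrite !classical_sets.in_set1/= ?andbT ?andbF
    ?mule0 ?adde0 ?add0e EFinM.
rewrite (integral_class_probabilityE (f := f) Deta)//; last 2 first.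
- move=> b; apply/measurable_EFinP; apply: measurable_funM => //.
  by case: b => //; exact: measurable_funB.
- move=> b x; rewrite lee_fin mulr_ge0//; case: b; rewrite ?subr_ge0.
    by have /andP[] := rho1_01 x.
  by have /andP[] := rhom1_01 x.
rewrite [RHS]integral_mkcond.
(* The target integral is over the marginal of [Dbar], which is that of [D]. *)
rewrite [RHS](eq_measure_integral (marginal D)); last first.
  by move=> B mB _; exact: ILN_marginal DDbar mB.
apply: eq_integral => x _; rewrite patchE /f indicE -!EFinM -EFinD.
by case: ifPn => _; rewrite ?mulr1// !mulr0 !mul0r addr0.
Qed.

End class_probability_theory.

(** * Single index noise preserves single index models *)

Theorem proposition9 (R : realType) (d : nat)
    (X : set 'rV[R]_d) (X0 : X !=set0)
    (D Dbar : probability (domain X0 * bool)%type R)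
    (eta : domain X0 -> R) (L W Lm1 L1 : R)
    (u : R -> R) (w : 'rV[R]_d) (fm1 f1 : R -> R)
    (L_ge0 : 0 <= L) (W_ge0 : 0 <= W)
    (pi_01 : (0 < D ([set: domain X0] `*` [set true]) < 1)%E)
    (D_eta : class_probability D eta)
    (uw_SIM : SIM_parameters L W u w)
    (eta_GLM : eta = GLM X0 u w)
    (fm1_01 : unit_valued fm1) (f1_01 : unit_valued f1)
    (noise_lt1 : bounded_total_noise (fm1 \o score X0 w) (f1 \o score X0 w))
    (Dbar_SIN : SIN D w fm1 f1 Dbar)
    (admissible : BCNp_admissible fm1 f1 (score X0 w) eta)
    (fm1_lip : Lm1.-lipschitz fm1) (f1_lip : L1.-lipschitz f1) :
  let ubar (z : R) := (1 - f1 z) * u z + fm1 z * (1 - u z) in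
  (exists etabar : domain X0 -> R,
    [/\ class_probability Dbar etabar,
        SIM X0 (L + Lm1 + L1) W etabar &
        forall x, etabar x = ubar (score X0 w x)]) /\
  (forall etabar : domain X0 -> R, class_probability Dbar etabar ->
    {ae marginal Dbar, forall x, etabar x = ubar (score X0 w x)}).
Proof.
move: uw_SIM => [u01 u_homo u_lip wW] ubar.
have mscore := @measurable_score R d X X0 w.
have etabar_cp : class_probability Dbar (ubar \o score X0 w).
  have mlink (k : R) (f : R -> R) : k.-lipschitz f ->
      measurable_fun [set: domain X0] (f \o score X0 w).
    by move=> /lipschitz_measurable mf; exact: measurableT_comp mf mscore.
  have := ILN_class_probability (mlink _ _ fm1_lip) (mlink _ _ f1_lip)
    (fun=> fm1_01 _) (fun=> f1_01 _) D_eta Dbar_SIN.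
  by rewrite eta_GLM.
split; last by move=> etabar /class_probability_ae_unique; apply.
(* [ubar] is [noisy_link u fm1 f1] up to unfolding. *)
have ubar_lip : (L + Lm1 + L1).-lipschitz ubar by exact: noisy_link_lipschitz.
have ubar_homo : {in range (score X0 w) &, {homo ubar : z z' / z <= z'}}.
  by rewrite eta_GLM in admissible; exact: noisy_link_homo.
have range_neq0 : range (score X0 w) !=set0.
  by exists (score X0 w point); exists point.
have [|g [g01 g_homo g_lip g_ubar]] :=
    monotone_lipschitz_extension range_neq0 _ ubar_homo ubar_lip.
  by move=> z _; exact: noisy_link01.
exists (ubar \o score X0 w); split=> //.
exists g, w; split; first by split.
by apply/funext => x; rewrite /GLM g_ubar// inE; exists x.
Qed.
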